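(* Let $R \cong R_1\times\cdots\times R_r$ ($r\ge 1$) with finite commutative local rings $R_i$. Then the number of non-zero zero-divisors of $R$, i.e. the number of vertices of the zero-divisor graph $\Gamma(R)$, equals $$\# V(\Gamma(R)) = \prod_{i=1}^r \# R_i - \prod_{i=1}^r \# V(\mathrm U(R_i)) - 1 = \prod_{i=1}^r \# R_i - \prod_{i=1}^r \# U(R_i) - 1 .$$
   Context: Rings are finite and commutative with $1\neq 0$. The zero-divisor graph $\Gamma(R)$ has as vertex set $Z^*(R)$ the set of non-zero zero-divisors of $R$, with $x,y$ adjacent iff $xy=0$. $U(R)$ denotes the set of units of $R$, and the graph $\mathrm U(R_i)$ (the unit graph) has vertex set $U(R_i)$ and no edges. $\#S$ is the cardinality of a set $S$. *)

(* Defs.v *)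
From HB Require Import structures.
From mathcomp Require Import all_boot all_order all_algebra.

Set Implicit Arguments.
Unset Strict Implicit.
Unset Printing Implicit Defensive.

Import GRing.Theory.
Local Open Scope ring_scope.

(* [idealr_closed M] says that M is a proper ideal (1 \notin M is included). *)
Definition maximal_ideal (R : finComNzRingType) (M : {set R}) : Prop :=
  idealr_closed M /\
  forall J : {set R}, idealr_closed J -> M \subset J -> J = M.

Definition local_ring (R : finComNzRingType) : Prop :=
  exists! M : {set R}, maximal_ideal M.

(* MathComp puts a ring structure on {ffun I -> R} only, i.e. on constant families; *)
(* here R_ i may depend on i. *)
Definition direct_product (I : finType) (R_ : I -> finComUnitRingType) :=
  {dffun forall i, R_ i}.

Section DirectProduct.
Variables (I : finType) (R_ : I -> finComUnitRingType).
Local Notation P := (direct_product R_).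

HB.instance Definition _ := Finite.on P.

Definition dp_zero : P := [ffun i => 0].
Definition dp_one : P := [ffun i => 1].
Definition dp_opp (x : P) : P := [ffun i => - x i].
Definition dp_add (x y : P) : P := [ffun i => x i + y i].
Definition dp_mul (x y : P) : P := [ffun i => x i * y i].

Fact dp_addA : associative dp_add.
Proof. by move=> x y z; apply/ffunP=> i; rewrite !ffunE addrA. Qed.
Fact dp_addC : commutative dp_add.
Proof. by move=> x y; apply/ffunP=> i; rewrite !ffunE addrC. Qed.
Fact dp_add0 : left_id dp_zero dp_add.
Proof. by move=> x; apply/ffunP=> i; rewrite !ffunE add0r. Qed.
Fact dp_addN : left_inverse dp_zero dp_opp dp_add.
Proof. by move=> x; apply/ffunP=> i; rewrite !ffunE addNr. Qed.

HB.instance Definition _ :=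
  GRing.isZmodule.Build P dp_addA dp_addC dp_add0 dp_addN.

Fact dp_mulA : associative dp_mul.
Proof. by move=> x y z; apply/ffunP=> i; rewrite !ffunE mulrA. Qed.
Fact dp_mulC : commutative dp_mul.
Proof. by move=> x y; apply/ffunP=> i; rewrite !ffunE mulrC. Qed.
Fact dp_mul1 : left_id dp_one dp_mul.
Proof. by move=> x; apply/ffunP=> i; rewrite !ffunE mul1r. Qed.
Fact dp_mulDl : left_distributive dp_mul dp_add.
Proof. by move=> x y z; apply/ffunP=> i; rewrite !ffunE mulrDl. Qed.

HB.instance Definition _ :=
  GRing.Zmodule_isComPzRing.Build P dp_mulA dp_mulC dp_mul1 dp_mulDl.

End DirectProduct.

Definition ring_isomorphic (R S : pzRingType) : Prop :=
  exists f : {rmorphism R -> S}, bijective f.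

(* Undirected graphs without multiple edges; loops are not excluded. *)
Record graph := Graph {
  vertex : finType;
  adj : rel vertex;
  adj_sym : symmetric adj
}.

Definition zero_divisor (R : finComNzRingType) (x : R) : bool :=
  [exists y : R, (y != 0) && (x * y == 0)].

Definition nonzero_zero_divisors (R : finComNzRingType) : {set R} :=
  [set x : R | (x != 0) && zero_divisor x].

Fact zero_divisor_adj_sym (R : finComNzRingType) :
  symmetric (fun x y : {x : R | x \in nonzero_zero_divisors R} =>
               val x * val y == 0).
Proof. by move=> x y; rewrite mulrC. Qed.

(* x, y are adjacent iff x * y = 0, so x has a loop when x ^+ 2 = 0. *)
Definition zero_divisor_graph (R : finComNzRingType) : graph :=
  Graph (@zero_divisor_adj_sym R).

Definition ring_units (R : finComUnitRingType) : {set R} :=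
  [set x : R | x \is a GRing.unit].

Fact no_edge_sym (T : Type) : symmetric (fun _ _ : T => false).
Proof. by []. Qed.

Definition unit_graph (R : finComUnitRingType) : graph :=
  Graph (@no_edge_sym {x : R | x \in ring_units R}).

(* Main.v *)
(* In a finite commutative ring, every element that is not a zero divisor is
   invertible, since multiplication by it is an injective self-map of a finite
   set.  So the vertices of the zero-divisor graph are the elements that are
   neither 0 nor invertible, and an element of a product is invertible exactly
   when all its components are. *)
Require Import Defs.
From mathcomp Require Import all_boot all_order all_algebra.

Set Implicit Arguments.
Unset Strict Implicit.
Unset Printing Implicit Defensive.

Local Open Scope ring_scope.

Import GRing.Theory.

(** Since [R] carries no unit predicate, invertibility is expressed by a witness, a form that ring
    morphisms carry over directly. *)
Lemma not_zero_divisorP (R : finComNzRingType) (x : R) :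
  reflect (exists y, x * y = 1) (~~ zero_divisor x).
Proof.
apply: (iffP idP) => [nzd_x | [y xy1]].
  have mulx_inj : injective ( *%R x).
    move=> a b eq_ab; apply/eqP; rewrite -subr_eq0; apply: contraNT nzd_x => ab_neq0.
    by apply/existsP; exists (a - b); rewrite ab_neq0 mulrBr eq_ab subrr eqxx.
  by have [g _ gK] := injF_bij mulx_inj; exists (g 1); rewrite gK.
apply/existsPn => z; apply/negP => /andP[/eqP z_neq0 /eqP xz0]; apply: z_neq0.
by rewrite -[z]mul1r -xy1 mulrAC xz0 mul0r.
Qed.

(** The additive form avoids truncated subtraction; the summand 1 counts the element 0. *)
Lemma card_nonzero_zero_divisors (R : finComNzRingType) :
  (#|nonzero_zero_divisors R| + #|[set x : R | ~~ zero_divisor x]| + 1 = #|R|)%N.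
Proof.
pose Z := [set x : R | zero_divisor x].
have zd0 : 0 \in Z.
  (* As 1 is non-zero, it witnesses that 0 is itself a zero divisor. *)
  by rewrite inE; apply/existsP; exists 1; rewrite oner_neq0 mul0r eqxx.
have -> : nonzero_zero_divisors R = Z :\ 0 by apply/setP => x; rewrite !inE.
have -> : [set x : R | ~~ zero_divisor x] = ~: Z.
  by apply/setP => x; rewrite !inE.
by rewrite -(cardsC Z) (cardsD1 0 Z) zd0 addnC addnA.
Qed.

Section DirectProductUnits.
Variables (I : finType) (R_ : I -> finComUnitRingType).
Local Notation P := (direct_product R_).

Lemma card_direct_product : #|P| = (\prod_i #|R_ i|)%N.
Proof. by rewrite card_dep_ffun foldrE big_image. Qed.

(** Membership in a [family] is what lets [card_family] turn the count of invertible elements into a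
    product. *)
Lemma direct_product_invertibleP (u : P) :
  reflect (exists v : P, u * v = 1) (u \in family (fun i => ring_units (R_ i))).
Proof.
apply: (iffP familyP) => [u_unit | [v uv1] i].
  exists [ffun i => (u i)^-1]; apply/ffunP => i; rewrite !ffunE divrr //.
  by have := u_unit i; rewrite inE.
rewrite inE; apply/unitrPr; exists (v i).
by move/ffunP/(_ i): uv1; rewrite !ffunE.
Qed.

Lemma card_not_zero_divisor (R : finComNzRingType) :
  ring_isomorphic R P ->
  #|[set x : R | ~~ zero_divisor x]| = (\prod_i #|ring_units (R_ i)|)%N.
Proof.
case=> f f_bij; have [g fK gK] := f_bij.
have <- : #|[set u : P | u \in family (fun i => ring_units (R_ i))]|
            = (\prod_i #|ring_units (R_ i)|)%N.
  by rewrite cardsE card_family foldrE big_image.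
rewrite -(card_imset _ (bij_inj f_bij)); apply: eq_card => u.
rewrite [RHS]inE; apply/imsetP/direct_product_invertibleP => [[x] | [v uv1]].
  rewrite inE => /not_zero_divisorP[y xy1] ->.
  by exists (f y); rewrite -rmorphM xy1 rmorph1.
exists (g u); last by rewrite gK.
rewrite inE; apply/not_zero_divisorP; exists (g v).
(* Only [f] is given as a morphism, not its inverse [g], so the equation is checked after applying
   [f]. *)
by apply: (bij_inj f_bij); rewrite rmorphM rmorph1 !gK.
Qed.

End DirectProductUnits.

Theorem theorem3p1 (r : nat) (R : finComNzRingType)
    (R_ : 'I_r -> finComUnitRingType)
    (r_ge1 : (1 <= r)%N)
    (R_local : forall i : 'I_r, local_ring (R_ i))
    (R_iso : ring_isomorphic R (direct_product R_)) :
  [/\ #|nonzero_zero_divisors R| = #|vertex (zero_divisor_graph R)|,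
      #|vertex (zero_divisor_graph R)|%:Z
        = (\prod_(i < r) #|R_ i|)%N%:Z
          - (\prod_(i < r) #|vertex (unit_graph (R_ i))|)%N%:Z - 1
    & (\prod_(i < r) #|R_ i|)%N%:Z
          - (\prod_(i < r) #|vertex (unit_graph (R_ i))|)%N%:Z - 1
        = (\prod_(i < r) #|R_ i|)%N%:Z
          - (\prod_(i < r) #|ring_units (R_ i)|)%N%:Z - 1].
Proof.
have card_unit_graph i : #|vertex (unit_graph (R_ i))| = #|ring_units (R_ i)|.
  by rewrite /= card_sig.
have card_graph :
    #|nonzero_zero_divisors R| = #|vertex (zero_divisor_graph R)|.
  by rewrite /= card_sig.
rewrite (eq_bigr _ (fun i _ => card_unit_graph i)); split=> //.
have [f /bij_eq_card card_R] := R_iso.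
(* The product of the [#|R_ i|] becomes [#|R|], then the three-term sum; in the integers the unit
   count and the 1 for the element 0 cancel. *)
rewrite -card_graph -card_direct_product -card_R -card_nonzero_zero_divisors.
by rewrite (card_not_zero_divisor R_iso) !PoszD [RHS]addrAC !addrK.
Qed.
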